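(* Let $S>1$, $n_1\ge 0$ and $n_2\ge 1$ be integers and consider a partial matrix whose specified entries exhibit an arrowhead structure, i.e. $$\begin{pmatrix}X&Z_1^{\mathsf T}&Z_2^{\mathsf T}&\cdots&Z_S^{\mathsf T}\\Z_1&Y_{1,1}&*&\cdots&*\\Z_2&*&Y_{2,2}&\cdots&*\\ \vdots&\vdots&\vdots&\ddots&\vdots\\Z_S&*&*&\cdots&Y_{S,S}\end{pmatrix},$$ where $X\in\mathcal{S}^{n_1}$, $Y_{i,i}\in\mathcal{S}^{n_2}$, $Z_i\in\mathbb{R}^{n_2\times n_1}$, $i\in[1:S]$, are fully specified and the blocks marked $*$ are entirely unspecified. Let $G_{spec}$ be its specification graph. Then $G_{spec}$ is chordal. If $n_1\in\{0,1\}$, then $G_{spec}$ is also a block-clique graph, which is not the case otherwise (i.e. if $n_1\ge2$, $G_{spec}$ is not a block-clique graph).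
   Context: $\mathcal{S}^m$ is the space of real symmetric $m\times m$ matrices; $[1:S]=\{1,\dots,S\}$. The specification graph of a partial matrix of order $n$ has vertices $v_1,\dots,v_n$, and $\{v_i,v_j\}$ (for $i\neq j$) is an edge if and only if the entry in position $(i,j)$ is specified. A graph is chordal if every cycle of length greater than 3 has a chord (an edge joining two vertices of the cycle that is not an edge of the cycle). A clique is a set of vertices inducing a complete subgraph. A block of a graph is a subgraph that is connected, has no cut vertex (no disconnected subgraph is obtained by removing just one vertex and its adjacent edges from it), and is not contained in any other subgraph with these two properties. A block-clique graph is a graph whose blocks are cliques (complete subgraphs). *)

(* Defs.v *)
From mathcomp Require Import all_boot all_order all_algebra.
From mathcomp Require Import reals.
Set Implicit Arguments.
Unset Strict Implicit.
Unset Printing Implicit Defensive.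
Import GRing.Theory.
Local Open Scope ring_scope.

Section Graphs.
Variable T : finType.

(* Finite simple graphs with vertices taken in T.  The vertex set is a subset
   of T, so that the subgraphs of a graph are again of type [graph]. *)
Record graph := Graph {
  verts : {set T};
  edges : {set {set T}};
  edgesP : [forall a in edges, (#|a| == 2) && (a \subset verts)] }.

Implicit Types (G H K : graph) (x y v : T) (c : seq T).

Definition adj G : rel T := fun x y => [set x; y] \in edges G.

(* Not necessarily induced. *)
Definition subgraph H G :=
  verts H \subset verts G /\ edges H \subset edges G.

Lemma del_vertex_subproof G v :
  [forall a in [set a in edges G | v \notin a],
     (#|a| == 2) && (a \subset verts G :\ v)].
Proof.
apply/forall_inP => a; rewrite inE => /andP[aG va].
by have /forall_inP/(_ a aG)/andP[-> aV] := edgesP G; rewrite subsetD1 aV va.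
Qed.

Definition del_vertex G v := Graph (del_vertex_subproof G v).

(* The graph without vertices counts as connected, so that an isolated vertex
   is not a cut vertex of the one-vertex graph. *)
Definition connected G : Prop :=
  forall x y, x \in verts G -> y \in verts G -> connect (adj G) x y.

Definition cut_vertex G v := v \in verts G /\ ~ connected (del_vertex G v).

Definition connected_no_cut G := connected G /\ forall v, ~ cut_vertex G v.

Definition block G H :=
  [/\ subgraph H G, connected_no_cut H &
      forall K, subgraph K G -> connected_no_cut K -> subgraph H K -> K = H].

Definition complete G : Prop :=
  forall x y, x \in verts G -> y \in verts G -> x != y -> adj G x y.

Definition block_clique G := forall H, block G H -> complete H.

(* A cycle of length [size c] is a duplicate-free sequence c of vertices,
   cyclically adjacent; it is a genuine graph cycle when [2 < size c]. *)
Definition cycle_edges c : {set {set T}} := [set [set x; next c x] | x in c].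

Definition has_chord G c : Prop :=
  exists a : {set T}, [/\ a \in edges G, a \subset c & a \notin cycle_edges c].

Definition chordal G : Prop :=
  forall c, ucycle (adj G) c -> (3 < size c)%N -> has_chord G c.

End Graphs.

Section PartialMatrices.
Variable R : Type.

(* A partial matrix of order n is a matrix over [option R], in which [None]
   stands for an unspecified entry. *)
Definition spec_edges n (A : 'M[option R]_n) : {set {set 'I_n}} :=
  [set [set p.1; p.2] | p : 'I_n * 'I_n & (p.1 != p.2) && isSome (A p.1 p.2)].

Lemma spec_graph_subproof n (A : 'M[option R]_n) :
  [forall a in spec_edges A, (#|a| == 2) && (a \subset [set: 'I_n])].
Proof.
apply/forall_inP => a /imsetP[[i j]]; rewrite inE /= => /andP[ij _] ->.
by rewrite cards2 ij subsetT.
Qed.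

Definition spec_graph n (A : 'M[option R]_n) : graph 'I_n :=
  Graph (spec_graph_subproof A).

Lemma adj_spec_graph n (A : 'M[option R]_n) (i j : 'I_n) :
  A^T = A -> adj (spec_graph A) i j = (i != j) && isSome (A i j).
Proof.
move=> sA; apply/imsetP/andP => [[[k l]]|[ij Aij]]; last first.
  by exists (i, j); rewrite // inE ij.
rewrite inE /= => /andP[kl Akl] eq_ijkl.
have ij : i != j.
  by move/(congr1 (fun B : {set _} => #|B|)): eq_ijkl; rewrite !cards2 kl; case: eqP.
split=> //.
have: k \in [set i; j] by rewrite eq_ijkl !inE eqxx.
have: l \in [set i; j] by rewrite eq_ijkl !inE eqxx orbT.
rewrite !inE => /orP[]/eqP El /orP[]/eqP Ek; subst k l.
- by rewrite eqxx in kl.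
- by rewrite -sA mxE.
- exact: Akl.
- by rewrite eqxx in kl.
Qed.

Definition specified m n (B : 'M[R]_(m, n)) : 'M[option R]_(m, n) :=
  map_mx Some B.

Definition unspecified m n : 'M[option R]_(m, n) := const_mx None.

Definition arrowhead S n1 n2 (X : 'M[R]_n1) (Y : 'I_S -> 'M[R]_n2)
    (Z : 'I_S -> 'M[R]_(n2, n1)) : 'M[option R]_(n1 + \sum_(i < S) n2) :=
  block_mx
    (specified X)
    (\mxrow_(j < S) specified (Z j)^T)
    (\mxcol_(i < S) specified (Z i))
    (\mxblock_(i < S, j < S)
       (if i == j then specified (Y i) else unspecified n2 n2)).

Lemma tr_arrowhead S n1 n2 (X : 'M[R]_n1) (Y : 'I_S -> 'M[R]_n2)
    (Z : 'I_S -> 'M[R]_(n2, n1)) :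
  X^T = X -> (forall i, (Y i)^T = Y i) -> (arrowhead X Y Z)^T = arrowhead X Y Z.
Proof.
move=> sX sY; rewrite /arrowhead tr_block_mx tr_mxrow tr_mxcol tr_mxblock.
rewrite /specified map_trmx sX; congr block_mx.
- by apply: eq_mxrow => j; rewrite map_trmx.
- by apply: eq_mxcol => i; rewrite map_trmx trmxK.
- apply: eq_mxblock => i j; rewrite eq_sym; case: eqP => [->|_].
    by rewrite map_trmx sY.
  exact: trmx_const.
Qed.

End PartialMatrices.

(* Main.v *)
(** Label each vertex by the diagonal block Y_{k,k} it belongs to, or by [None]
    if it belongs to X: two distinct vertices are adjacent iff one of them is
    unlabelled or both carry the same label.  If a, b, c, d are consecutive on
    a cycle, then {b, d} is a chord when b is unlabelled, and {a, c} is one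
    otherwise.  A path joining two labels goes through an unlabelled vertex;
    if there is only one such vertex, it is a cut vertex of every connected
    subgraph meeting two labels, so each block lives on a clique.  Two
    unlabelled vertices, being adjacent to everything, make the whole graph a
    (noncomplete) block. *)

Require Import Defs.
From mathcomp Require Import all_boot all_order all_algebra.
From mathcomp Require Import reals.
Local Open Scope ring_scope.

Set Implicit Arguments.
Unset Strict Implicit.
Unset Printing Implicit Defensive.

Section Graphs.
Variable T : finType.
Implicit Types (G H K : graph T) (u v w x y : T).

Lemma graph_inj G H : verts G = verts H -> edges G = edges H -> G = H.
Proof.
case: G H => [VG EG GP] [VH EH HP] /= EV EE; subst VH EH.
by congr Graph; apply: bool_irrelevance.
Qed.

Lemma subgraph_anti G H : subgraph G H -> subgraph H G -> G = H.
Proof.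
by move=> [v1 e1] [v2 e2]; apply: graph_inj; apply/eqP; rewrite eqEsubset ?v1 ?e1.
Qed.

Lemma adj_sym G x y : adj G x y = adj G y x.
Proof. by rewrite /adj setUC. Qed.

Lemma adj_subgraph H G x y : subgraph H G -> adj H x y -> adj G x y.
Proof. by move=> [_ /subsetP sHG] /sHG. Qed.

Lemma adj_del_vertex G v x y :
  adj (del_vertex G v) x y = [&& adj G x y, v != x & v != y].
Proof. by rewrite /adj !inE negb_or. Qed.

Lemma connect_invariant (e : rel T) (D : eqType) (f : T -> D) x y :
  (forall u v, e u v -> f u = f v) -> connect e x y -> f x = f y.
Proof.
move=> ef /connectP[p]; elim: p x => [|z p IHp] x /= => [_ -> //|].
by case/andP=> /ef-> /IHp.
Qed.

Lemma complete_connected G : complete G -> connected G.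
Proof.
move=> cG x y xG yG; have [->|xy] := eqVneq x y; first exact: connect0.
exact/connect1/cG.
Qed.

Lemma complete_del_vertex G v : complete G -> complete (del_vertex G v).
Proof.
move=> cG x y; rewrite !inE => /andP[xv xG] /andP[yv yG] xy.
by rewrite adj_del_vertex cG // !(eq_sym v) xv.
Qed.

Lemma complete_connected_no_cut G : complete G -> connected_no_cut G.
Proof.
move=> cG; split=> [|v [_ []]]; first exact: complete_connected.
exact/complete_connected/complete_del_vertex.
Qed.

Lemma clique_subproof (A : {set T}) :
  [forall a in [set a : {set T} | (#|a| == 2) && (a \subset A)],
     (#|a| == 2) && (a \subset A)].
Proof. by apply/forall_inP => a; rewrite inE. Qed.

Definition clique (A : {set T}) := Graph (clique_subproof A).

Lemma complete_clique A : complete (clique A).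
Proof.
by move=> x y xA yA xy; rewrite /adj inE cards2 xy subUset !sub1set xA.
Qed.

Lemma clique_subgraph G (A : {set T}) :
  A \subset verts G -> {in A &, forall x y, x != y -> adj G x y} ->
  subgraph (clique A) G.
Proof.
move=> AG adjA; split=> //; apply/subsetP => a; rewrite inE.
case/andP=> /cards2P[x [y [xy ->]]]; rewrite subUset !sub1set => /andP[xA yA].
exact: adjA.
Qed.

Lemma subgraph_clique H : subgraph H (clique (verts H)).
Proof.
split=> //; apply/subsetP => a aH; rewrite inE.
exact: (forall_inP (edgesP H)).
Qed.

Lemma block_complete G H : block G H ->
  {in verts H &, forall x y, x != y -> adj G x y} -> complete H.
Proof.
move=> [[vHG _] _ maxH] adjH; have cK := @complete_clique (verts H).
rewrite -(maxH (clique (verts H))) //.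
- exact: clique_subgraph.
- exact: complete_connected_no_cut.
- exact: subgraph_clique.
Qed.

Definition universal G u := forall x, x \in verts G -> x != u -> adj G x u.

Lemma universal_connected G u : universal G u -> connected G.
Proof.
move=> Gu; have toG x : x \in verts G -> connect (adj G) x u.
  move=> xG; have [->|xu] := eqVneq x u; first exact: connect0.
  exact/connect1/Gu.
move=> x y /toG xu /toG yu; apply: connect_trans xu _.
by rewrite (sym_connect_sym (adj_sym G)).
Qed.

Lemma universal_del_vertex G u v :
  universal G u -> u != v -> universal (del_vertex G v) u.
Proof.
move=> Gu uv x; rewrite !inE => /andP[xv xG] xu.
by rewrite adj_del_vertex Gu // !(eq_sym v) xv.
Qed.

Lemma universal2_block G u v :
  universal G u -> universal G v -> u != v -> block G G.
Proof.
move=> Gu Gv uv; split=> [||K KG _ GK]; [by split | | exact: subgraph_anti].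
split=> [|w [_ []]]; first exact: universal_connected Gu.
have [Euw|uw] := eqVneq u w; last first.
  exact: universal_connected (universal_del_vertex Gu uw).
have vw : v != w by rewrite -Euw eq_sym.
exact: universal_connected (universal_del_vertex Gv vw).
Qed.

Lemma cycle_edges_set2 (c : seq T) x y :
  x != y -> [set x; y] \in cycle_edges c -> (next c x == y) || (next c y == x).
Proof.
move=> xy /imsetP[z _ E]; have := set21 x y; have := set22 x y.
rewrite E !inE => /orP[]/eqP Ey /orP[]/eqP Ex; subst.
- by rewrite eqxx in xy.
- by rewrite eqxx orbT.
- by rewrite eqxx.
- by rewrite eqxx in xy.
Qed.

Section Labelled.
Variables (L : eqType) (G : graph T) (lab : T -> option L).
Hypothesis adjG : forall x y,
  adj G x y = (x != y) && [|| lab x == None, lab y == None | lab x == lab y].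

Lemma labelled_chordal : chordal G.
Proof.
move=> [|a [|b [|c [|d s]]]] // /andP[cyc uniq_s] _.
have [Nac Nbd] : [set a; c] \notin cycle_edges [:: a, b, c, d & s] /\
                 [set b; d] \notin cycle_edges [:: a, b, c, d & s].
  move: uniq_s; rewrite /= !inE !negb_or.
  case/and5P=> /and4P[ab ac ad a_s] /and3P[bc bd b_s] /andP[cd c_s] d_s _.
  have [ba ca da] : [/\ b != a, c != a & d != a] by rewrite !(eq_sym _ a).
  have [cb db dc] : [/\ c != b, d != b & d != c].
    by rewrite !(eq_sym _ b) (eq_sym d c).
  split; apply/negP => /cycle_edges_set2.
    by rewrite ac /= !eqxx (negPf ca) (negPf cb) (negPf bc) (negPf da) => /(_ isT).
  rewrite bd /= !eqxx (negPf ba) (negPf db) (negPf da) (negPf dc) (negPf cd) => /(_ isT).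
  case: s a_s b_s {cyc d_s c_s} => [|e s] _; rewrite /= ?eqxx ?(negPf ab) //.
  by rewrite !inE negb_or (eq_sym e) => /andP[/negPf-> _].
have [ab bc] : adj G a b /\ adj G b c by move: cyc => /= /and3P[].
have [ac bd] : a != c /\ b != d.
  move: uniq_s => /=; rewrite !inE !negb_or.
  by case/and3P=> /and4P[_ -> _ _] /and3P[_ ->].
have [/eqP lb|lb] := boolP (lab b == None).
  exists [set b; d]; split=> //; first by rewrite -/(adj G b d) adjG bd lb.
  by apply/subsetP => z /set2P[]->; rewrite !inE eqxx ?orbT.
exists [set a; c]; split=> //; last by apply/subsetP => z /set2P[]->; rewrite !inE eqxx ?orbT.
rewrite -/(adj G a c) adjG ac /=.
move: ab bc; rewrite !adjG (negPf lb) /= => /andP[_ +] /andP[_ +].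
by case/orP=> [-> //|/eqP->] /orP[->|->]; rewrite ?orbT.
Qed.

Lemma labelled_block_clique :
  (forall x y, lab x = None -> lab y = None -> x = y) -> block_clique G.
Proof.
move=> lab_inj H bH; apply: (block_complete bH) => x y xH yH xy.
have [sHG [cH ncH] _] := bH; rewrite adjG xy /=.
have [//|lx] := eqVneq (lab x) None; have [//|ly /=] := eqVneq (lab y) None.
apply/negP => /negP/eqP lxy.
have [/existsP[v /andP[vH /eqP lv]]|/existsPn noN] :=
    boolP [exists v, (v \in verts H) && (lab v == None)].
  apply: (ncH v); split=> // cHv; apply: lxy.
  apply: (@connect_invariant (adj (del_vertex H v)) _ lab); last first.
    apply: cHv; rewrite !inE ?xH ?yH andbT.
      by apply: contraNneq lx => ->; rewrite lv.
    by apply: contraNneq ly => ->; rewrite lv.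
  move=> p q; rewrite adj_del_vertex => /and3P[/(adj_subgraph sHG)].
  rewrite adjG => /andP[_ /or3P[/eqP lp|/eqP lq|/eqP //]] vp vq.
    by rewrite (lab_inj _ _ lp lv) eqxx in vp.
  by rewrite (lab_inj _ _ lq lv) eqxx in vq.
apply: lxy; apply: (@connect_invariant (adj H) _ lab); last exact: cH.
move=> p q pq; move: (adj_subgraph sHG pq).
have := forall_inP (edgesP H) _ pq; rewrite subUset !sub1set => /and3P[_ pH qH].
move: (noN p) (noN q); rewrite pH qH adjG /= => /negPf-> /negPf->.
by case/andP=> _ /eqP.
Qed.

Lemma labelled_not_block_clique u v x y :
  lab u = None -> lab v = None -> u != v ->
  x \in verts G -> y \in verts G ->
  lab x != None -> lab y != None -> lab x != lab y -> ~ block_clique G.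
Proof.
move=> lu lv uv xG yG lx ly lxy bc.
have univ w : lab w = None -> universal G w.
  by move=> lw z _ zw; rewrite adjG zw lw eqxx orbT.
have /bc cG := universal2_block (univ _ lu) (univ _ lv) uv.
have /(cG _ _ xG yG) : x != y by apply: contraNneq lxy => ->.
by rewrite adjG (negPf lx) (negPf ly) (negPf lxy) andbF.
Qed.

End Labelled.
End Graphs.

Definition arrow_label S n1 n2 (i : 'I_(n1 + \sum_(k < S) n2)) : option 'I_S :=
  match split i with inl _ => None | inr j => Some (tagnat.sig1 j) end.

Lemma isSome_arrowhead (R : Type) S n1 n2 (X : 'M[R]_n1) (Y : 'I_S -> 'M[R]_n2)
    (Z : 'I_S -> 'M[R]_(n2, n1)) i j :
  isSome (arrowhead X Y Z i j) =
  [|| arrow_label i == None, arrow_label j == None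
    | arrow_label i == arrow_label j].
Proof.
rewrite /arrow_label /arrowhead -{1}(splitK i) -{1}(splitK j).
case: (split i) => k; case: (split j) => l /=.
- by rewrite block_mxEul mxE.
- by rewrite block_mxEur !mxE.
- by rewrite block_mxEdl !mxE.
rewrite block_mxEdr mxE /=.
by rewrite (inj_eq Some_inj); case: ifP => _; rewrite mxE.
Qed.

Theorem lemma4 (R : realType) (S n1 n2 : nat)
    (hS : (1 < S)%N) (hn2 : (1 <= n2)%N)
    (X : 'M[R]_n1) (Y : 'I_S -> 'M[R]_n2) (Z : 'I_S -> 'M[R]_(n2, n1))
    (hX : X^T = X) (hY : forall i : 'I_S, (Y i)^T = Y i) :
  let G_spec := spec_graph (arrowhead X Y Z) in
  [/\ chordal G_spec,
      n1 = 0%N \/ n1 = 1%N -> block_clique G_spec &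
      (2 <= n1)%N -> ~ block_clique G_spec].
Proof.
have adjE i j : adj (spec_graph (arrowhead X Y Z)) i j =
    (i != j) && [|| arrow_label i == None, arrow_label j == None
                  | arrow_label i == arrow_label j].
  by rewrite adj_spec_graph ?tr_arrowhead // isSome_arrowhead.
have labl (k : 'I_n1) : arrow_label (lshift (\sum_(k < S) n2) k) = None.
  by rewrite /arrow_label (unsplitK (inl k)).
have labr (k : 'I_S) (l : 'I_n2) :
    arrow_label (rshift n1 (@tagnat.Rank _ (fun=> n2) k l)) = Some k.
  by rewrite /arrow_label (unsplitK (inr _)) tagnat.Rank1K.
move=> G; split; first exact: labelled_chordal adjE.
- move=> n1_le1; apply: (labelled_block_clique adjE) => i j.
  rewrite /arrow_label; case: splitP => // k ik _; case: splitP => // l jl _.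
  apply: val_inj; rewrite /= ik jl.
  by case: n1_le1 k l {ik jl} => -> k l; rewrite ?ord1 //; case: k.
- move=> n1_ge2.
  pose i0 := Ordinal (ltnW n1_ge2); pose i1 := Ordinal n1_ge2.
  pose k0 := Ordinal (ltnW hS); pose k1 := Ordinal hS; pose l := Ordinal hn2.
  apply: (labelled_not_block_clique adjE (labl i0) (labl i1)
    (x := rshift n1 (@tagnat.Rank _ (fun=> n2) k0 l))
    (y := rshift n1 (@tagnat.Rank _ (fun=> n2) k1 l))); rewrite ?inE ?labr //.
Qed.
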